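(* Let $\varepsilon>0$ and let $G$ be a finite $\varepsilon$-quasirandom group. Then the derived length of the solvable radical of $G$ is at most $2\varepsilon^{-1}$.
   Context: A finite group $G$ is $\varepsilon$-quasirandom if every nontrivial irreducible complex representation of $G$ has degree at least $|G|^{\varepsilon}$. The solvable radical of $G$ is its largest solvable normal subgroup. *)

(* Defs.v *)
From HB Require Import structures.
From mathcomp Require Import all_boot all_order all_algebra.
From mathcomp Require Import all_fingroup all_solvable mxrepresentation.
From mathcomp Require Import complex.
From mathcomp Require Import reals exp.

Set Implicit Arguments.
Unset Strict Implicit.
Unset Printing Implicit Defensive.

Import Order.TTheory GRing.Theory Num.Theory GroupScope.

(* [R[i]] is the field of complex numbers, as [R : realType]. The predicate
   [mx_irreducible] forces the degree [n] to be positive; an irreducible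
   representation on which every element acts as the identity is the trivial
   one (of degree 1). *)
Definition quasirandom (R : realType) (eps : R) (gT : finGroupType)
    (G : {group gT}) : Prop :=
  forall (n : nat) (rG : mx_representation R[i] G n),
    mx_irreducible rG ->
    ~ (forall x, x \in G -> rG x = 1%:M%R) ->
    (#|G|%:R `^ eps <= n%:R :> R)%R.

Definition is_solvable_radical (gT : finGroupType) (G S : {group gT}) : Prop :=
  [/\ S <| G, solvable S
    & forall H : {group gT}, H <| G -> solvable H -> H \subset S].

Lemma solvable_radical_exists (gT : finGroupType) (G : {group gT}) :
  exists S : {group gT}, is_solvable_radical G S.
Proof.
pose P (H : {group gT}) := (H <| G) && solvable H.
have P1 : P 1%G by rewrite /P normal1 solvable1.
case: (@arg_maxnP _ 1%G P (fun H => #|H|) P1) => S /andP[nSG solS] maxS.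
exists S; split=> // H nHG solH.
have nSH : H \subset 'N(S) by apply: subset_trans (normal_sub nHG) (normal_norm nSG).
have nsY : S <| H <*> S by rewrite /normal joing_subr join_subG nSH normG.
have PY : P (H <*> S)%G.
  rewrite /P /= normalY //= (series_sol nsY) solS.
  by rewrite quotientYidr // quotient_sol.
have eqY : S :=: H <*> S.
  by apply/eqP; rewrite eqEcard joing_subr; exact: maxS _ PY.
by rewrite eqY joing_subl.
Qed.

Lemma solvable_radical_unique (gT : finGroupType) (G S T : {group gT}) :
  is_solvable_radical G S -> is_solvable_radical G T -> S = T.
Proof.
move=> [nS solS maxS] [nT solT maxT].
by apply/val_inj/eqP; rewrite /= eqEsubset maxT // maxS.
Qed.

(* The least [n] such that [G^`(n) = 1], for [G] solvable: such an [n] is then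
   less than [#|G|], so the search can be bounded as in [nil_class]. *)
Definition derived_length (gT : finGroupType) (G : {set gT}) : nat :=
  index 1 (mkseq (fun n => G^`(n)) #|G|).

Lemma derived_lengthP (gT : finGroupType) (n : nat) (G : {group gT}) :
  solvable G -> reflect (G^`(n) = 1) (derived_length G <= n).
Proof.
move=> solG; rewrite /derived_length; set s := mkseq _ _; set c := index 1 s.
have lt_c_G : c < #|G|.
  have bnd k : #|G^`(k)| <= (#|G|.-1 - k).+1.
    elim: k => [|k IHk]; first by rewrite subn0 prednK.
    rewrite dergSn subnS -ltnS.
    have [-> | ntGk] := eqVneq G^`(k) 1; first by rewrite commG1 cards1.
    case: (_ - _) IHk => [|k']; first by rewrite leqNgt cardG_gt1 ntGk.
    apply: leq_trans (proper_card _).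
    exact: sol_der1_proper (der_sub _ _) _.
  have G1 : G^`(#|G|.-1) = 1.
    by rewrite [G^`(_)]card_le1_trivg // (leq_trans (bnd _)) ?subnn.
  rewrite -(size_mkseq (fun n => G^`(n)) #|G|) index_mem.
  by apply/mapP; exists #|G|.-1; rewrite ?mem_iota ?add0n ?prednK /=.
case: leqP => [le_c_n | lt_n_c].
  left; apply/trivgP; have <- : nth 1 s c = 1.
    by rewrite nth_index // -index_mem size_mkseq.
  rewrite nth_mkseq // -(subnK le_c_n).
  by elim: (n - c) => // k IHk; rewrite addSn; exact: subset_trans (der_subS _ _) IHk.
right; apply/eqP/negPf; rewrite -(before_find 1 lt_n_c) nth_mkseq //.
exact: ltn_trans lt_n_c lt_c_G.
Qed.

(* Main.v *)
(* A nontrivial permutation action of G on n points has a nontrivial irreducible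
   constituent of degree at most n, so n >= |G|^eps. If S^(j+1) > S^(j+2), then
   G acts nontrivially by conjugation on the cosets of S^(j+2) in S^(j):
   otherwise S^(j+1) <= [S^(j), G] <= S^(j+2). Each double step of the derived
   series therefore contributes a factor |G|^eps to |G|. When the derived length
   is odd, the extra factor comes from G acting by translation on the cosets of
   S', so that |G|^(eps * ceil(d/2)) <= |G| in all cases. *)
Require Import Defs.
From mathcomp Require Import all_boot all_order all_algebra.
From mathcomp Require Import all_fingroup all_solvable mxrepresentation.
From mathcomp Require Import complex.
From mathcomp Require Import reals exp.

Set Implicit Arguments.
Unset Strict Implicit.
Unset Printing Implicit Defensive.

Import Order.TTheory GRing.Theory Num.Theory GroupScope.

(** Over an arbitrary field a simple submodule is found by excluded middle, hence [classically]. *)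
Lemma nontrivial_irr_constituent (F : fieldType) (gT : finGroupType)
    (G : {group gT}) n (rG : mx_representation F G n) :
  [pchar F]%R^'.-group G -> ~ (forall x, x \in G -> rG x = 1%:M%R) ->
  classically (exists m (rH : mx_representation F G m),
    [/\ m <= n, mx_irreducible rH & ~ (forall x, x \in G -> rH x = 1%:M%R)]).
Proof.
move=> charG ntrG.
(* W is a complement to the fixed vectors: its simple submodules are nontrivial. *)
have [W modW defW dxW] := mx_Maschke_pchar rG charG (rfix_mx_module rG) (submx1 _).
have nzW : W != 0%R.
  apply/eqP=> W0; apply: ntrG => x Gx.
  rewrite -[rG x]mul1mx; apply: (rfix_mxP G) x Gx.
  by rewrite -defW W0 addsmx_sub submx_refl sub0mx.
move=> b IHb; apply: (mxsimple_exists modW nzW) => -[V simV sVW].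
have [modV nzV _] := simV.
apply: IHb; exists (\rank V), (submod_repr modV); split.
- exact: rank_leq_row.
- exact/submod_mx_irr.
(* If [G] acted trivially on [V], then [V] would lie in both [W] and the fixed space, which meet in
   0. *)
move=> trV; case/negP: nzV; rewrite -submx0 -(mxdirect_addsP dxW) sub_capmx sVW andbT.
apply/rfix_mxP=> x Gx; rewrite -(in_submodK (submx_refl V)) -(val_submodJ modV) //.
by rewrite -[submod_mx _ _]/(submod_repr modV x) trV // mulmx1.
Qed.

Section PermutationRepresentation.

Variables (F : fieldType) (aT : finGroupType) (rT : finType) (G : {group aT}).
Variables (A : {set rT}) (to : {action aT &-> rT}).
Hypothesis actsGA : [acts G, on A | to].

Definition perm_repr_mx (x : aT) : 'M[F]_#|A| :=
  \matrix_(i, j) (to (enum_val i) x == enum_val j)%:R%R.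

Lemma perm_repr_mx_repr : mx_repr G perm_repr_mx.
Proof.
split=> [|x y Gx Gy]; apply/matrixP=> i j; rewrite !mxE.
  by rewrite act1 (inj_eq enum_val_inj).
have Aix : to (enum_val i) x \in A by rewrite (acts_act actsGA) // enum_valP.
(* In the matrix product only the index of the intermediate point, the image of point [i] under [x],
   can contribute. *)
rewrite (bigD1 (enum_rank_in Aix (to (enum_val i) x))) //= !mxE.
rewrite enum_rankK_in // eqxx mul1r actM big1 ?addr0 // => k neq_k.
rewrite !mxE; case: eqP => [def_k | _]; last by rewrite mul0r.
by case/eqP: neq_k; apply: enum_val_inj; rewrite enum_rankK_in.
Qed.

Canonical perm_repr := MxRepresentation perm_repr_mx_repr.

Lemma perm_repr_nontrivial x a :
  x \in G -> a \in A -> to a x != a ->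
  ~ (forall y, y \in G -> perm_repr y = 1%:M%R).
Proof.
move=> Gx Aa ntxa /(_ x Gx)/matrixP.
move=> /(_ (enum_rank_in Aa a) (enum_rank_in Aa a))/eqP.
by rewrite !mxE eqxx enum_rankK_in // (negPf ntxa) eq_sym oner_eq0.
Qed.

End PermutationRepresentation.

Lemma der_length_proper (gT : finGroupType) (S : {group gT}) j :
  solvable S -> j < derived_length S -> S^`(j.+1) \proper S^`(j).
Proof.
move=> solS ltjd; rewrite dergSn; apply: (sol_der1_proper solS (der_sub _ _)).
by apply/eqP=> /(derived_lengthP _ solS); rewrite leqNgt ltjd.
Qed.

Section Quasirandom.

Variables (R : realType) (eps : R) (gT : finGroupType) (G : {group gT}).
Hypothesis qrG : quasirandom eps G.

Lemma quasirandom_action (rT : finType) (A : {set rT}) (to : {action gT &-> rT})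
    x a :
  [acts G, on A | to] -> x \in G -> a \in A -> to a x != a ->
  (#|G|%:R `^ eps <= #|A|%:R :> R)%R.
Proof.
move=> actsGA Gx Aa ntxa.
have charG : [pchar R[i]]%R^'.-group G.
  by rewrite /pgroup pcharf'_nat pnatr_eq0 -lt0n.
have ntrA := perm_repr_nontrivial (F := R[i]) (actsGA := actsGA) Gx Aa ntxa.
(* The goal is a boolean inequality, so [classically] can be eliminated here. *)
apply: (nontrivial_irr_constituent charG ntrA _) => -[m [rH [le_mA irrH ntH]]].
by apply: le_trans (qrG irrH ntH) _; rewrite ler_nat.
Qed.

(** Under right translation, any element of [G] outside [H] moves the coset [H] itself. *)
Lemma quasirandom_index (H : {group gT}) :
  H \proper G -> (#|G|%:R `^ eps <= #|G : H|%:R :> R)%R.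
Proof.
case/properP=> sHG [x Gx notHx].
apply: (quasirandom_action (actsRs_rcosets H G) Gx (a := H :* 1)).
  by apply/rcosetsP; exists 1.
by apply: contra notHx => /eqP /=; rewrite mulg1 rcosetE => <-; apply: rcoset_refl.
Qed.

(** Conjugation by [x] sends the coset [K :* h] to [K :* (h ^ x)], so it moves that coset as soon as
    the commutator of [h] and [x] is outside [K]. *)
Lemma quasirandom_section (H K : {group gT}) :
  H <| G -> K <| G -> K \subset H -> ~~ ([~: H, G] \subset K) ->
  (#|G|%:R `^ eps <= #|H : K|%:R :> R)%R.
Proof.
move=> nHG nKG sKH; rewrite gen_subG => /subsetPn[_ /imset2P[h x Hh Gx ->]] notKhx.
have Nx y : y \in G -> K :^ y = K by move=> Gy; rewrite (normsP (normal_norm nKG)).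
have actsG : [acts G, on rcosets K H | 'Js].
  apply/subsetP=> y Gy; rewrite !inE; apply/subsetP=> _ /rcosetsP[z Hz ->].
  rewrite !inE /= conjsMg conjg_set1 Nx //; apply/rcosetsP; exists (z ^ y) => //.
  by rewrite memJ_norm // (subsetP (normal_norm nHG)).
apply: (quasirandom_action actsG Gx (a := K :* h)).
  by apply/rcosetsP; exists h.
apply: contra notKhx => /eqP/=; rewrite conjsMg conjg_set1 Nx // => eqKh.
have : h ^ x \in K :* h by rewrite -eqKh rcoset_refl.
have nKh : h \in 'N(K).
  by rewrite (subsetP (normal_norm nKG)) // (subsetP (normal_sub nHG)).
(* Conjugating [h ^ x * h^-1] by [h] turns it into [h^-1 * h ^ x], the commutator. *)
by rewrite mem_rcoset -(memJ_norm _ nKh) [_ ^ h]conjgE mulgKV -commgEl.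
Qed.

Variable S : {group gT}.
Hypotheses (nSG : S <| G) (solS : solvable S).

Lemma quasirandom_der2 j :
  j.+1 < derived_length S ->
  (#|G|%:R `^ eps <= #|S^`(j) : S^`(j.+2)|%:R :> R)%R.
Proof.
move=> ltjd; have nG i : S^`(i) <| G by apply: char_normal_trans (der_char i S) nSG.
apply: quasirandom_section; rewrite ?nG //=.
  exact: subset_trans (der_subS _ _) (der_subS _ _).
apply: contraL (der_length_proper solS ltjd) => sK; rewrite properE negb_and negbK.
apply/orP; right; apply: subset_trans sK.
by rewrite dergSn commgS // normal_sub.
Qed.

(** Starting at [S] or [S'] according to the parity of the derived length lets the double steps end
    exactly at the trivial term. In the odd case the base of the induction is the translation action
    on the cosets of [S']. *)
Lemma quasirandom_der_index m :
  m.*2 + odd (derived_length S) <= derived_length S ->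
  ((#|G|%:R `^ eps) ^+ (m + odd (derived_length S))
     <= #|G : S^`(m.*2 + odd (derived_length S))|%:R :> R)%R.
Proof.
set d := derived_length S; have sG i : S^`(i) \subset G.
  exact: subset_trans (der_sub i S) (normal_sub nSG).
elim: m => [|m IHm]; rewrite ?add0n.
  case: (boolP (odd d)) => [odd_d _ | _ _] /=; last by rewrite expr0 ler1n.
  rewrite expr1; apply: quasirandom_index.
  apply: proper_sub_trans (normal_sub nSG); apply: (der_length_proper solS (j := 0)).
  exact: odd_gt0.
rewrite doubleS !addSn => le_m.
rewrite -(Lagrange_index (sG _) (subset_trans (der_subS _ _) (der_subS _ _))).
rewrite exprS natrM mulrC; apply: ler_pM; rewrite ?exprn_ge0 ?powR_ge0 //.
  by apply: IHm; apply: leq_trans le_m; rewrite !leqW.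
exact: quasirandom_der2.
Qed.

End Quasirandom.

Theorem proposition2p13 (R : realType) (eps : R) (gT : finGroupType)
    (G S : {group gT}) :
  (0 < eps)%R ->
  quasirandom eps G ->
  is_solvable_radical G S ->
  ((derived_length S)%:R <= 2 * eps^-1 :> R)%R.
Proof.
move=> eps_gt0 qrG [nSG solS _].
set d := derived_length S.
have [-> | d_gt0] := posnP d; first by rewrite mulr_ge0 // invr_ge0 ltW.
(* This makes [ln #|G|] positive, so that it can be cancelled below. *)
have G_gt1 : 1 < #|G|.
  apply: leq_trans (subset_leq_card (normal_sub nSG)); rewrite cardG_gt1.
  by apply/eqP=> S1; move: d_gt0; rewrite ltnNge; case/negP; apply/derived_lengthP.
have dE : d./2.*2 + odd d = d by rewrite addnC odd_double_half.
have := quasirandom_der_index qrG nSG solS (m := d./2).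
rewrite -/d dE => /(_ (leqnn _)) le_idx.
have {le_idx} : ((#|G|%:R `^ eps) ^+ (d./2 + odd d) <= #|G|%:R :> R)%R.
  by apply: le_trans le_idx _; rewrite ler_nat dvdn_leq // dvdn_indexg.
have G_gt0 : (0 < #|G|%:R :> R)%R by rewrite ltr0n ltnW.
(* With [k = d./2 + odd d], taking logarithms gives [k * eps <= 1]; the bound then follows from
   [d <= 2 * k]. *)
rewrite -ler_ln ?posrE ?exprn_gt0 ?powR_gt0 // lnXn ?powR_gt0 // ln_powR.
rewrite -[leLHS]mulr_natl mulrA ger_pMl ?ln_gt0 ?ltr1n // => le_k1.
rewrite ler_pdivlMr //; apply: le_trans (_ : 2 * ((d./2 + odd d)%:R * eps) <= _)%R.
  rewrite mulrA -natrM ler_pM2r // ler_nat -{1}dE mulnDr mul2n leq_add2l.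
  by rewrite leq_pmull.
by rewrite -[leRHS]mulr1 ler_pM2l.
Qed.
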